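(* Let $n\ge 4$ and let $p_1,\ldots,p_n\in\mathbb{R}^2$ be an $n$-point configuration which is reconstructible from distances. Assume that the distribution of the $I$'s of $p_1,\ldots,p_n$ is not symmetric, i.e. that the multiset of the values $I(p_{i_1},p_{i_2},p_{i_3},p_{i_4})$, $1\le i_1<i_2<i_3<i_4\le n$, is not the same as the multiset of the values $-I(p_{i_1},p_{i_2},p_{i_3},p_{i_4})$, $1\le i_1<i_2<i_3<i_4\le n$. Let $q_1,\ldots,q_n\in\mathbb{R}^2$ be another $n$-point configuration. Then the two configurations have both the same distribution of distances and the same distribution of the $I$'s if and only if there exist a rotation and a translation which map one point configuration onto the other, i.e. if and only if there exist $M\in SO(2)$, $T\in\mathbb{R}^2$ and a permutation $\pi$ of $\{1,\ldots,n\}$ such that $Mp_i+T=q_{\pi(i)}$ for all $i=1,\ldots,n$.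
   Context: For $q_i,q_j,q_k\in\mathbb{R}^2$ let $a_{q_i,q_j,q_k}=\det(q_i-q_k,\,q_j-q_k)$. Define $I:\mathbb{R}^2\times\mathbb{R}^2\times\mathbb{R}^2\times\mathbb{R}^2\to\mathbb{R}$ by \begin{align*} I(q_1,q_2,q_3,q_4)={}&(a_{q_1,q_2,q_4}^2-a_{q_1,q_3,q_4}^2)(a_{q_1,q_2,q_3}^2-a_{q_1,q_3,q_4}^2)(a_{q_1,q_2,q_3}^2-a_{q_1,q_2,q_4}^2)\\ &\cdot(a_{q_1,q_2,q_3}-a_{q_1,q_2,q_4}+2a_{q_1,q_3,q_4})(a_{q_1,q_2,q_3}-2a_{q_1,q_2,q_4}+a_{q_1,q_3,q_4})\\ &\cdot(2a_{q_1,q_2,q_3}-a_{q_1,q_2,q_4}+a_{q_1,q_3,q_4}). \end{align*} The distribution of the $I$'s of a configuration $q_1,\ldots,q_n\in\mathbb{R}^2$ is the multiset of the values $I(q_{i_1},q_{i_2},q_{i_3},q_{i_4})$ over all $1\le i_1<i_2<i_3<i_4\le n$. The distribution of distances of a configuration $q_1,\ldots,q_n\in\mathbb{R}^2$ is the multiset of the pairwise distances $\|q_i-q_j\|$, $1\le i<j\le n$. A configuration $p_1,\ldots,p_n\in\mathbb{R}^2$ is called reconstructible from distances if, for every $q_1,\ldots,q_n\in\mathbb{R}^2$ having the same distribution of distances, there exist an orthogonal $2\times2$ matrix $M$, a vector $T\in\mathbb{R}^2$ and a permutation $\pi$ of $\{1,\ldots,n\}$ such that $Mp_i+T=q_{\pi(i)}$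 for every $i=1,\ldots,n$. *)

(* Defs.v *)
(* The real line is an arbitrary R : realType, and a point of
   the plane is a column vector in 'cV[R]_2. *)
From mathcomp Require Import all_boot all_order all_fingroup all_algebra.
From mathcomp Require Import reals.
Set Implicit Arguments.
Unset Strict Implicit.
Unset Printing Implicit Defensive.
Import Order.TTheory GRing.Theory Num.Theory.
Local Open Scope ring_scope.

(* MathComp-Analysis's `|u| on vectors is the sup norm, hence this definition. *)
Definition euclidean_norm (R : realType) (m : nat) (u : 'cV[R]_m) : R :=
  Num.sqrt (\sum_i u i 0 ^+ 2).

Definition orthogonal_mx (R : realType) (m : nat) (M : 'M[R]_m) : Prop :=
  M^T *m M = 1%:M.

Definition special_orthogonal_mx (R : realType) (m : nat) (M : 'M[R]_m) : Prop :=
  orthogonal_mx M /\ \det M = 1.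

(* Twice the signed area of the triangle u v w. *)
Definition area (R : realType) (u v w : 'cV[R]_2) : R :=
  \det (row_mx (u - w) (v - w) : 'M[R]_2).

Definition invI (R : realType) (q1 q2 q3 q4 : 'cV[R]_2) : R :=
  (area q1 q2 q4 ^+ 2 - area q1 q3 q4 ^+ 2)
  * (area q1 q2 q3 ^+ 2 - area q1 q3 q4 ^+ 2)
  * (area q1 q2 q3 ^+ 2 - area q1 q2 q4 ^+ 2)
  * (area q1 q2 q3 - area q1 q2 q4 + 2%:R * area q1 q3 q4)
  * (area q1 q2 q3 - 2%:R * area q1 q2 q4 + area q1 q3 q4)
  * (2%:R * area q1 q2 q3 - area q1 q2 q4 + area q1 q3 q4).

(* The two distributions below are finite multisets, represented by sequences
   that are only ever compared up to reordering, by perm_eq. *)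

Definition distances (R : realType) (n : nat) (p : 'I_n -> 'cV[R]_2) : seq R :=
  [seq euclidean_norm (p ij.1 - p ij.2) |
     ij : 'I_n * 'I_n <- enum {: 'I_n * 'I_n} & (ij.1 < ij.2)%N].

Definition invIs (R : realType) (n : nat) (p : 'I_n -> 'cV[R]_2) : seq R :=
  [seq (let: (i, j, k, l) := t in invI (p i) (p j) (p k) (p l)) |
     t : 'I_n * 'I_n * 'I_n * 'I_n <- enum {: 'I_n * 'I_n * 'I_n * 'I_n} &
       (let: (i, j, k, l) := t in [&& (i < j)%N, (j < k)%N & (k < l)%N])].

Definition same_distances (R : realType) (n : nat) (p q : 'I_n -> 'cV[R]_2) : bool :=
  perm_eq (distances p) (distances q).

Definition same_invIs (R : realType) (n : nat) (p q : 'I_n -> 'cV[R]_2) : bool :=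
  perm_eq (invIs p) (invIs q).

Definition symmetric_invIs (R : realType) (n : nat) (p : 'I_n -> 'cV[R]_2) : bool :=
  perm_eq (invIs p) [seq - x | x <- invIs p].

Definition reconstructible_from_distances (R : realType) (n : nat)
    (p : 'I_n -> 'cV[R]_2) : Prop :=
  forall q : 'I_n -> 'cV[R]_2, same_distances p q ->
  exists (M : 'M[R]_2) (T : 'cV[R]_2) (s : {perm 'I_n}),
    orthogonal_mx M /\ forall i, M *m p i + T = q (s i).

(* Main.v *)
(* [invI] is invariant under all permutations of its four points, while an
   affine map x |-> Mx + T multiplies [area] by \det M and hence [invI], which is
   homogeneous of degree 9 in the areas, by (\det M)^9.  Reconstructibility
   yields an orthogonal M relating the two configurations; if \det M = -1 the
   distribution of the I's of q is the opposite of that of p, so equality of the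
   two distributions would make the one of p symmetric. *)
Require Import Defs.
From mathcomp Require Import all_boot all_order all_fingroup all_algebra.
From mathcomp Require Import reals.
From mathcomp Require Import ring.
Set Implicit Arguments.
Unset Strict Implicit.
Unset Printing Implicit Defensive.
Import GRing.Theory.
Local Open Scope ring_scope.

(** Adjacent transpositions generate all permutations: the head of [s] is carried to its place in
    [t] one swap at a time. Symmetry in four points thus reduces to three identities. *)
Lemma perm_swap_invariant (T : eqType) (U : Type) (g : seq T -> U) :
    (forall s x y t, g (s ++ x :: y :: t) = g (s ++ y :: x :: t)) ->
  forall s t, perm_eq s t -> g s = g t.
Proof.
move=> g_swap.
have g_move r x s t : g (r ++ x :: s ++ t) = g (r ++ s ++ x :: t).
  elim: s r => [//|y s IHs] r /=.
  by rewrite g_swap -(cat_rcons y r) IHs cat_rcons.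
(* The arbitrary prefix [r] is what lets the induction absorb the common head. *)
suff g_cat s : forall r t, perm_eq s t -> g (r ++ s) = g (r ++ t).
  by move=> s t; apply: (g_cat s [::]).
elim: s => [|x s IHs] r t st.
  by move: st; rewrite perm_sym => /perm_nilP ->.
have xt : x \in t by rewrite -(perm_mem st) mem_head.
case/splitPr: xt st => t1 t2 st.
have {}st : perm_eq s (t1 ++ t2).
  by rewrite -(perm_cons x) (perm_trans st)// -cat_rcons perm_sym -cat_cons
     perm_cat2r perm_sym perm_rcons.
by rewrite -g_move -!(cat_rcons x r); apply: IHs.
Qed.

Lemma sorted_ltn_enum (n : nat) (A : {set 'I_n}) :
  sorted ltn (map val (enum A)).
Proof.
have -> : enum A = filter (mem A) (enum 'I_n) by rewrite enumT.
rewrite sorted_map; apply: sorted_filter.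
  by move=> y x z /=; apply: ltn_trans.
by rewrite -sorted_map val_enum_ord iota_ltn_sorted.
Qed.

Lemma sorted_ltn_enumE (n : nat) (s : seq 'I_n) :
  sorted ltn (map val s) -> enum [set x in s] = s.
Proof.
move=> s_sorted; apply: (inj_map val_inj).
apply: (irr_sorted_eq ltn_trans ltnn) => //; first exact: sorted_ltn_enum.
by apply: eq_mem_map => x; rewrite mem_enum inE.
Qed.

Section SubsetEnumeration.
Variables (n k : nat) (I : finType) (f : I -> k.-tuple 'I_n) (P : pred I).
Hypothesis f_bij : bijective f.
Hypothesis P_sorted : forall t, P t = sorted ltn (map val (f t)).

(** An increasing tuple is the ordered enumeration of its set of entries. Passing to subsets trades
    the order condition [P], which relabelling destroys, for a cardinality condition, which it
    preserves. *)
Lemma perm_increasing_tuples :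
  perm_eq [seq val (f t) | t <- enum {: I} & P t]
    [seq enum A | A : {set 'I_n} <- enum {: {set 'I_n}} & #|A| == k].
Proof.
have [h fK hK] := f_bij.
apply: uniq_perm.
- rewrite map_inj_uniq; first by apply/filter_uniq/enum_uniq.
  move=> t u /val_inj.
  exact: (can_inj fK).
- rewrite map_inj_uniq; first by apply/filter_uniq/enum_uniq.
  move=> A B AB.
  by apply/setP => x; rewrite -mem_enum AB mem_enum.
- move=> s; apply/mapP/mapP => -[].
  + move=> t; rewrite mem_filter P_sorted => /andP[/sorted_ltn_enumE ft _] ->.
    exists [set x in val (f t)]; last by rewrite ft.
    by rewrite mem_filter mem_enum cardE ft size_tuple eqxx.
  + move=> A; rewrite mem_filter cardE => /andP[sA _] ->.
    exists (h (Tuple sA)); last by rewrite hK.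
    by rewrite mem_filter P_sorted hK sorted_ltn_enum mem_enum.
Qed.

(** Since [g] ignores order, each value depends only on a [k]-subset of indices, and [s] permutes
    these subsets by taking images. *)
Lemma perm_relabel (T : eqType) (U : eqType) (g : seq T -> U)
    (p q : 'I_n -> T) (s : {perm 'I_n}) :
    (forall r t, perm_eq r t -> g r = g t) -> (forall i, q (s i) = p i) ->
  perm_eq [seq g (map p (f t)) | t <- enum {: I} & P t]
          [seq g (map q (f t)) | t <- enum {: I} & P t].
Proof.
move=> g_perm qs.
pose G r (A : {set 'I_n}) := g (map r (enum A)).
have E r : perm_eq [seq g (map r (f t)) | t <- enum {: I} & P t]
    (map (G r) [seq A : {set 'I_n} <- enum {: {set 'I_n}} | #|A| == k]).
  rewrite (map_comp (g \o map r) (fun A : {set 'I_n} => enum A)).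
  rewrite [X in perm_eq X _](map_comp (g \o map r) (val \o f)).
  exact/perm_map/perm_increasing_tuples.
rewrite (perm_trans (E p))// perm_sym (perm_trans (E q))//.
have im_inj := imset_inj (@perm_inj _ s).
(* Applying [s] along [enum A] gives [enum (s @: A)] up to order, a difference that [g] does not
   see. *)
have -> : map (G p) [seq A : {set 'I_n} <- enum {: {set 'I_n}} | #|A| == k]
  = map (G q) [seq s @: A | A : {set 'I_n} <-
       [seq A : {set 'I_n} <- enum {: {set 'I_n}} | #|A| == k]].
  rewrite -map_comp; apply: eq_map => A; rewrite /G /=.
  rewrite (eq_map (fun i => esym (qs i))) (map_comp q s); apply: g_perm.
  apply/perm_map/uniq_perm; rewrite ?map_inj_uniq ?enum_uniq//.
    exact: perm_inj.
  by move=> x; rewrite mem_enum; apply/mapP/imsetP => -[y yA ->]; exists y;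
    rewrite // ?mem_enum// -mem_enum.
have uniqk := filter_uniq (fun A : {set 'I_n} => #|A| == k)
  (enum_uniq {: {set 'I_n}}).
apply/perm_map/uniq_perm; rewrite ?map_inj_uniq// => B.
rewrite mem_filter mem_enum andbT; apply/idP/mapP.
  move=> cB; exists ((s^-1)%g @: B).
    by rewrite mem_filter mem_enum andbT card_imset//; apply: perm_inj.
  by rewrite -imset_comp (eq_imset _ (permKV s)) imset_id.
case=> A; rewrite mem_filter => /andP[cA _] ->.
by rewrite card_imset//; apply: perm_inj.
Qed.

End SubsetEnumeration.

Section Plane.
Variable R : realType.
Implicit Types (u v w x T : 'cV[R]_2) (M : 'M[R]_2).

Lemma det_mx22 M : \det M = M 0 0 * M 1 1 - M 0 1 * M 1 0.
Proof.
have l0 : lift 0 0 = 1 :> 'I_2 by apply: val_inj.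
have l1 : lift 1 0 = 0 :> 'I_2 by apply: val_inj.
rewrite (expand_det_row _ 0) !big_ord_recl big_ord0 /cofactor !det_mx11 !mxE.
rewrite !l0 !l1 /= expr0 expr1; ring.
Qed.

Lemma areaE u v w : area u v w =
  (u 0 0 - w 0 0) * (v 1 0 - w 1 0) - (v 0 0 - w 0 0) * (u 1 0 - w 1 0).
Proof.
have El (a b : 'cV[R]_2) i : (row_mx a b : 'M_2) i 0 = a i 0.
  by rewrite -(row_mxEl a b i 0); congr (row_mx a b i _); apply: val_inj.
have Er (a b : 'cV[R]_2) i : (row_mx a b : 'M_2) i 1 = b i 0.
  by rewrite -(row_mxEr a b i 0); congr (row_mx a b i _); apply: val_inj.
rewrite /area det_mx22 !El !Er !mxE; ring.
Qed.

(** Once its differences of squares are split, [invI] is a product of nine linear forms in the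
    areas. Each adjacent swap permutes them up to an even number of sign changes; for this first
    swap one uses [area v w x = area u v w - area u v x + area u w x]. *)
Lemma invI_swap12 u v w x : invI v u w x = invI u v w x.
Proof. rewrite /invI !areaE; ring. Qed.

Lemma invI_swap23 u v w x : invI u w v x = invI u v w x.
Proof. rewrite /invI !areaE; ring. Qed.

Lemma invI_swap34 u v w x : invI u v x w = invI u v w x.
Proof. rewrite /invI !areaE; ring. Qed.

Lemma affineB M T u v : M *m u + T - (M *m v + T) = M *m (u - v).
Proof. by rewrite opprD addrACA subrr addr0 mulmxBr. Qed.

Lemma area_affine M T u v w :
  area (M *m u + T) (M *m v + T) (M *m w + T) = \det M * area u v w.
Proof. by rewrite /area !affineB -mul_mx_row det_mulmx. Qed.

Lemma invI_affine M T u v w x :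
  invI (M *m u + T) (M *m v + T) (M *m w + T) (M *m x + T)
  = \det M ^+ 9 * invI u v w x.
Proof. rewrite /invI !area_affine; ring. Qed.

Lemma euclidean_normN (m : nat) (u : 'cV[R]_m) :
  euclidean_norm (- u) = euclidean_norm u.
Proof. by congr Num.sqrt; apply: eq_bigr => i _; rewrite mxE sqrrN. Qed.

Lemma euclidean_norm_orthogonal (m : nat) (M : 'M[R]_m) (u : 'cV[R]_m) :
  orthogonal_mx M -> euclidean_norm (M *m u) = euclidean_norm u.
Proof.
have sqE (v : 'cV[R]_m) : \sum_i v i 0 ^+ 2 = (v^T *m v) 0 0.
  by rewrite mxE; apply: eq_bigr => i _; rewrite mxE.
by move=> MM; rewrite /euclidean_norm !sqE trmx_mul mulmxA -(mulmxA _ M^T) MM mulmx1.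
Qed.

Lemma det_orthogonal (m : nat) (M : 'M[R]_m) :
  orthogonal_mx M -> \det M = 1 \/ \det M = - 1.
Proof.
move=> /(congr1 determinant); rewrite det_mulmx det_tr det1 -expr2 => /eqP.
by rewrite sqrf_eq1 => /orP[]/eqP; [left|right].
Qed.

(* The values off the intended lengths 2 and 4 are irrelevant. *)
Let dist_seq (s : seq 'cV[R]_2) : R :=
  if s is [:: u; v] then euclidean_norm (u - v) else 0.

Let invI_seq (s : seq 'cV[R]_2) : R :=
  if s is [:: u; v; w; x] then invI u v w x else 0.

Lemma distances_relabel (n : nat) (p q : 'I_n -> 'cV[R]_2) (s : {perm 'I_n}) :
  (forall i, q (s i) = p i) -> perm_eq (distances p) (distances q).
Proof.
pose f (t : 'I_n * 'I_n) : 2.-tuple 'I_n := [tuple t.1; t.2].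
have f_bij : bijective f.
  exists (fun t => (tnth t 0, tnth t 1)); first by case.
  by case=> -[|i [|j []]] // ?; apply: val_inj.
have f_sorted (t : 'I_n * 'I_n) : (t.1 < t.2)%N = sorted ltn (map val (f t)).
  by rewrite /= andbT.
apply: (perm_relabel f_bij f_sorted (g := dist_seq)).
(* Off length 2 both sides are 0, so only the swap of the two endpoints remains. *)
apply: perm_swap_invariant => -[|a [|b [|c r]]] u v [|d [|e t]] //=.
by rewrite -opprB euclidean_normN.
Qed.

Lemma invIs_relabel (n : nat) (p q : 'I_n -> 'cV[R]_2) (s : {perm 'I_n}) :
  (forall i, q (s i) = p i) -> perm_eq (invIs p) (invIs q).
Proof.
pose f (t : 'I_n * 'I_n * 'I_n * 'I_n) : 4.-tuple 'I_n :=
  [tuple t.1.1.1; t.1.1.2; t.1.2; t.2].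
have f_bij : bijective f.
  exists (fun t => (tnth t 0, tnth t 1, tnth t 2%:R, tnth t 3%:R)).
    by move=> [[[i j] k] l].
  by case=> -[|i [|j [|k [|l []]]]] // ?; apply: val_inj.
pose P (t : 'I_n * 'I_n * 'I_n * 'I_n) :=
  let: (i, j, k, l) := t in [&& (i < j)%N, (j < k)%N & (k < l)%N].
have f_sorted t : P t = sorted ltn (map val (f t)).
  by case: t => [[[i j] k] l]; rewrite /= andbT.
have invIsE r : invIs r =
    [seq invI_seq (map r (f t)) | t <- enum {: 'I_n * 'I_n * 'I_n * 'I_n} & P t].
  by apply: eq_map => -[[[i j] k] l].
rewrite !invIsE; apply: (perm_relabel f_bij f_sorted).
apply: perm_swap_invariant.
(* Only total length 4 is left: a prefix of 0, 1 or 2 points gives the three adjacent swaps in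
   turn. *)
move=> [|a [|b [|c [|d [|d1 r]]]]] u v [|w [|x [|x1 t]]] //=.
- exact: invI_swap12.
- exact: invI_swap23.
- exact: invI_swap34.
Qed.

End Plane.

Unset Implicit Arguments.

Theorem proposition3p1 (R : realType) (n : nat) (n_ge4 : (4 <= n)%N)
    (p : 'I_n -> 'cV[R]_2)
    (p_reconstructible : reconstructible_from_distances p)
    (p_not_symmetric : ~~ symmetric_invIs p)
    (q : 'I_n -> 'cV[R]_2) :
  (same_distances p q /\ same_invIs p q) <->
  exists (M : 'M[R]_2) (T : 'cV[R]_2) (s : {perm 'I_n}),
    special_orthogonal_mx M /\ forall i : 'I_n, M *m p i + T = q (s i).
Proof.
(* Serves both directions: with determinant -1 to rule out reflections, and with determinant 1 for
   the converse. *)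
have invIs_q (M : 'M[R]_2) T (s : {perm 'I_n}) :
    (forall i, M *m p i + T = q (s i)) ->
    perm_eq [seq \det M ^+ 9 * x | x <- invIs p] (invIs q).
  move=> pq.
  have <- : invIs (fun i => M *m p i + T) = [seq \det M ^+ 9 * x | x <- invIs p].
    rewrite /invIs -map_comp; apply: eq_map => -[[[i j] k] l] /=.
    exact: invI_affine.
  by apply: (invIs_relabel (s := s)) => i; rewrite pq.
split=> [[/p_reconstructible [M [T [s [M_orth pq]]]] pq_invIs]|].
  exists M, T, s; split=> //; split=> //.
  have [//|detM] := det_orthogonal M_orth.
  case/negP: p_not_symmetric; apply: perm_trans pq_invIs _.
  rewrite perm_sym; apply: perm_trans (invIs_q _ _ _ pq).
  (* The exponent 9 is odd, so the scaling factor is -1; an even degree would not detect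
     reflections. *)
  rewrite detM -signr_odd expr1.
  by rewrite (eq_map (@mulN1r R)).
case=> M [T [s [[M_orth detM] pq]]]; split.
  rewrite /same_distances.
  have <- : distances (fun i => M *m p i + T) = distances p.
    by apply: eq_map => t; rewrite affineB euclidean_norm_orthogonal.
  by apply: (distances_relabel (s := s)) => i; rewrite pq.
have := invIs_q _ _ _ pq; rewrite detM expr1n.
by rewrite (eq_map (@mul1r R)) map_id.
Qed.
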